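(* Let $\dot U_{m+1}\subset\dot{\mathbb{R}}^{m+1}$ and $U_n\subset\mathbb{R}^n$ be open sets, let $a\in\dot U_{m+1}$ and $b\in U_n$, and let $f:\dot U_{m+1}\times U_n\to\mathbb{R}^n$ be a function with $f(a,b)=0$. Suppose there is a constant $M>0$ such that $$|f(t,x,y)-f(s,z,w)|\le M\bigl(|x-z|+|t-s|^{1/2}+|y-w|\bigr)$$ for all $(t,x),(s,z)\in\dot U_{m+1}$ and $y,w\in U_n$, and that there is a constant $K>0$ such that $$|f(t,x,y)-f(t,x,w)|\ge K|y-w|$$ for all $(t,x)\in\dot U_{m+1}$ and $y,w\in U_n$. Then there exist an open set $\dot V_{m+1}\subset\dot{\mathbb{R}}^{m+1}$ with $a\in\dot V_{m+1}\subset\dot U_{m+1}$, a function $\varphi:\dot V_{m+1}\to U_n$, and a constant $M'>0$ such that $$|\varphi(t,x)-\varphi(s,z)|\le M'\bigl(|x-z|+|t-s|^{1/2}\bigr)\quad\text{for all }(t,x),(s,z)\in\dot V_{m+1},$$ and $$\{(t,x,y)\in\dot V_{m+1}\times U_n:\ f(t,x,y)=0\}=\{(t,x,\varphi(t,x)):\ (t,x)\in\dot V_{m+1}\}.$$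
   Context: $\dot{\mathbb{R}}^{m+1}=\{(t,x):t\in\mathbb{R},\ x\in\mathbb{R}^m\}$ denotes $\mathbb{R}^{m+1}$ with a distinguished first (time) coordinate $t$. $|\cdot|$ denotes the absolute value on $\mathbb{R}$ or the Euclidean norm on $\mathbb{R}^k$. Open sets are with respect to the usual Euclidean topology. For $(t,x)\in\dot U_{m+1}$ and $y\in U_n$ we write $f(t,x,y)$ for $f((t,x),y)$. *)

(* Defs.v *)
From HB Require Import structures.
From mathcomp Require Import all_boot all_order all_algebra.
From mathcomp Require Import all_classical all_reals all_analysis.

Set Implicit Arguments.
Unset Strict Implicit.
Unset Printing Implicit Defensive.

Import Order.TTheory GRing.Theory Num.Theory.
Import numFieldNormedType.Exports.

Local Open Scope ring_scope.

(* The library norm on ['rV[R]_k] is the sup norm, so the Euclidean norm is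
   introduced separately; both induce the canonical (product) topology. *)
Definition enorm (R : realType) (k : nat) (x : 'rV[R]_k) : R :=
  Num.sqrt (\sum_(i < k) x ord0 i ^+ 2).

(* Main.v *)
Require Import Defs.
From HB Require Import structures.
From mathcomp Require Import all_boot all_order all_algebra all_fingroup.
From mathcomp Require Import all_classical all_reals all_analysis.
From mathcomp Require Import ring lra zify.

Set Implicit Arguments.
Unset Strict Implicit.
Unset Printing Implicit Defensive.

Import Order.TTheory GRing.Theory Num.Theory.
Import numFieldNormedType.Exports.

Local Open Scope classical_set_scope.
Local Open Scope ring_scope.

(* The point is solvability of f(p, y) = 0 for p near a: a bi-Lipschitz map of
   a cube into R^n whose value at the centre is small has a zero.  Uniqueness
   and the Hölder estimate for the solution then follow from the lower bound.

   A hypothetical bi-Lipschitz f without zero is refuted as in Kulpa's proof of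
   invariance of domain.  Its inverse extends to a Lipschitz map G of R^n
   (McShane).  Push the image of f out of a small cube around 0: since 0 is not
   attained, y |-> G (push_out y) is Lipschitz on the image of f, and it still
   inverts f up to r.  The G-image of the boundary of the small cube is too thin
   to contain every small w, so for a suitable w the map
   x |-> G (push_out (f x)) - w is bounded away from 0, which contradicts the
   Poincaré-Miranda theorem.

   The Poincaré-Miranda theorem is proved on a grid by cohomology of the torus
   (Z/(N+2))^n with coefficients of characteristic 2: the cup product of the n
   coordinate classes is nonzero, hence so is that of any cohomologous cochains,
   in particular of those that record the sign changes of the n components. *)

(** * Cup products of edge cochains on a triangulated torus *)

Section TorusCells.
Variables (F : comNzRingType) (pcharF2 : 2%N \in [pchar F]).

Let addFF (x : F) : x + x = 0. Proof. exact: addrr_pchar2. Qed.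

(** Multiplication by [tperm i j] matches odd with even permutations, so each value of [H] is
    counted twice, which gives 0 in characteristic 2. *)
Lemma perm_sum_tperm n (i j : 'I_n) (H : 'S_n -> F) :
  i != j -> (forall s, H (tperm i j * s)%g = H s) -> \sum_s H s = 0.
Proof.
move=> ij HH; rewrite (bigID (@odd_perm _)) /=.
rewrite (reindex_inj (mulgI (tperm i j))) /=.
rewrite [X in X + _](eq_big (fun s : 'S_n => ~~ odd_perm s) H) ?addFF //.
by move=> s; rewrite odd_mul_tperm ij.
Qed.

Variables (V : finZmodType) (n : nat) (e : 'I_n.+1 -> V).
Implicit Types (v : V) (s : 'S_n.+1) (c : V -> F).
Implicit Types (al : V -> 'I_n.+1 -> F).

(* A cell is a vertex v with a permutation s giving the order in which the n+1
   directions are travelled; [vert v s j] is its vertex after j steps, and edge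
   i goes from [vert v s i] in direction [s i]. *)
Definition vert v s (j : nat) : V := v + \sum_(p < n.+1 | (p < j)%N) e (s p).

(* A 1-cochain takes a vertex and the direction of an edge leaving it. *)
Definition closed_cochain al := forall v d d',
  al v d + al (v + e d) d' = al v d' + al (v + e d') d.

Definition coboundary c : V -> 'I_n.+1 -> F := fun v d => c v + c (v + e d).

Definition cup (al : 'I_n.+1 -> V -> 'I_n.+1 -> F) : F :=
  \sum_v \sum_s \prod_i al i (vert v s i) (s i).

(* One factor of the cup product is a 0-cochain c read at vertex q, and edge g
   of the cell is skipped. *)
Definition gap_cup c (be : 'I_n -> V -> 'I_n.+1 -> F) (g q : nat) : F :=
  \sum_v \sum_s c (vert v s q) *
    \prod_i be i (vert v s (bump g i)) (s (inord (bump g i))).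

Lemma vertS v s (p : 'I_n.+1) : vert v s p.+1 = vert v s p + e (s p).
Proof.
rewrite /vert (bigD1 p) //= -addrA; congr (_ + _); rewrite addrC; congr (_ + _).
by apply: eq_bigl => i; rewrite ltnS andbC -val_eqE /= ltn_neqAle.
Qed.

(** Exchanging two consecutive steps alters the set of the first [q] steps only when [q] falls
    between them. *)
Lemma vert_tperm v s (i j : 'I_n.+1) (q : nat) : j = i.+1 :> nat -> q != j ->
  vert v (tperm i j * s)%g q = vert v s q.
Proof.
move=> ji qj; rewrite /vert (reindex_inj (@perm_inj _ (tperm i j))).
congr (_ + _); apply: eq_big => [p|p _]; last by rewrite permM tpermK.
have ijq : (i < q)%N = (j < q)%N by move: qj; rewrite ji => qj; apply/idP/idP; lia.
by case: tpermP => [->|->|] //; rewrite -?topredE /= ijq.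
Qed.

(* The cochain [be g] moves across vertex g+1; by closedness the difference is
   invariant under exchanging the two steps at that vertex, so cells cancel in
   pairs. *)
Lemma gap_cupS c be (g q : nat) : (forall i, closed_cochain (be i)) ->
  (g < n)%N -> q != g.+1 -> gap_cup c be g q = gap_cup c be g.+1 q.
Proof.
move=> cl gn qg; apply/eqP; rewrite -subr_eq0 oppr_pchar2 //.
rewrite /gap_cup -big_split big1 //= => v _; rewrite -big_split /=.
set g0 : 'I_n := Ordinal gn.
have gn1 : (g < n.+1)%N by rewrite ltnW.
set i := Ordinal gn1; set j := Ordinal (gn : (g.+1 < n.+1)%N).
have ij : i != j by rewrite -val_eqE /= neq_ltn ltnSn.
apply: (perm_sum_tperm ij) => s.
have key s1 : c (vert v s1 q) *
   \prod_i0 be i0 (vert v s1 (bump g i0)) (s1 (inord (bump g i0))) +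
   c (vert v s1 q) *
   \prod_i0 be i0 (vert v s1 (bump g.+1 i0)) (s1 (inord (bump g.+1 i0))) =
   c (vert v s1 q) *
   (\prod_(i0 | i0 != g0) be i0 (vert v s1 (bump g i0)) (s1 (inord (bump g i0)))) *
   (be g0 (vert v s1 i) (s1 i) + be g0 (vert v s1 i + e (s1 i)) (s1 j)).
  rewrite [\prod_i0 _](bigD1 g0) //= [in X in _ + X](bigD1 g0) //=.
  have -> : bump g g = g.+1 by rewrite /bump leqnn.
  have -> : bump g.+1 g = g by rewrite /bump ltnn.
  have -> : inord g.+1 = j by apply: val_inj; rewrite /= inordK.
  have -> : inord g = i by apply: val_inj; rewrite /= inordK.
  rewrite -(vertS v s1 i) /=.
  have -> : \prod_(i0 < n | i0 != g0) be i0 (vert v s1 (bump g.+1 i0)) (s1 (inord (bump g.+1 i0))) =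
     \prod_(i0 < n | i0 != g0) be i0 (vert v s1 (bump g i0)) (s1 (inord (bump g i0))).
    apply: eq_bigr => p pg; suff -> : bump g.+1 p = bump g p by [].
    by move: pg; rewrite -val_eqE /= /bump; lia.
  by ring.
rewrite !key; congr (_ * _ * _).
- by rewrite vert_tperm.
- apply: eq_bigr => p; rewrite -val_eqE /= => pg.
  rewrite vert_tperm //; last by rewrite /= /bump; lia.
  have bpn : (bump g p < n.+1)%N by rewrite /bump; have := ltn_ord p; lia.
  rewrite permM tpermD // -val_eqE /= inordK // /bump; move: pg; case: (leqP g p) => /= ? ?; lia.
- rewrite !permM tpermL tpermR vert_tperm //=.
  exact: cl.
Qed.

(* Travelling the first direction last instead of first shifts a cell by one
   step. *)
Lemma gap_cup_shift c be (q : nat) : (q <= n)%N ->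
  gap_cup c be 0 q.+1 = gap_cup c be n q.
Proof.
move=> qn; rewrite /gap_cup.
have kinj : injective (@ordS n.+1) by apply: (can_inj (@ordSK _)).
pose k := perm kinj.
rewrite [LHS]exchange_big [RHS]exchange_big /=.
rewrite [RHS](reindex_inj (mulgI k)); apply: eq_bigr => s _.
rewrite [RHS](reindex_inj (addIr (e (s ord0)))); apply: eq_bigr => v _.
have kE (p : 'I_n.+1) : (p < n)%N -> k p = p.+1 :> nat.
  by move=> pn; rewrite permE /= modn_small.
have vE (r : nat) : (r <= n)%N ->
    vert (v + e (s ord0)) (k * s)%g r = vert v s r.+1.
  elim: r => [|r IH] rn.
    rewrite (vertS v s ord0) /vert !big_pred0 ?addr0 //.
  have rn1 : (r < n.+1)%N by rewrite ltnW.
  rewrite (vertS _ _ (Ordinal rn1)) /= IH ?(ltnW rn)//.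
  rewrite (vertS _ _ (Ordinal (rn : (r.+1 < n.+1)%N))) /= permM.
  by congr (_ + e (s _)); apply: val_inj; rewrite /= kE.
rewrite vE //; congr (_ * _); apply: eq_bigr => i _.
have bi : bump n i = i by rewrite /bump leqNgt ltn_ord.
rewrite bi /bump leq0n add1n vE ?(ltnW (ltn_ord i)) // permM.
congr (be i _ (s _)); apply: val_inj.
have i1 := ltn_ord i; have i2 := ltnW (i1 : (i.+1 <= n)%N).
by rewrite /= kE !inordK //; exact: leq_trans i1 _.
Qed.

(** Expanding the exact factor leaves two gap products with gap [k], reading [c] at vertices [k] and
    [k+1]. The gap of the first slides up to [n], that of the second down to 0, neither crossing the
    vertex where [c] is read. The cyclic shift identifies the results, and they cancel. *)
Lemma cup_exact (al : 'I_n.+1 -> V -> 'I_n.+1 -> F) k c :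
  (forall i, i != k -> closed_cochain (al i)) ->
  (forall v d, al k v d = coboundary c v d) -> cup al = 0.
Proof.
move=> cl ex; pose be i := al (lift k i).
have clb i : closed_cochain (be i) by apply: cl; rewrite eq_sym neq_lift.
have -> : cup al = gap_cup c be k k + gap_cup c be k k.+1.
  rewrite /gap_cup -big_split; apply: eq_bigr => v _.
  rewrite -big_split; apply: eq_bigr => s _ /=.
  rewrite (bigD1_ord k) //= ex /coboundary -vertS -mulrDl; congr (_ * _).
  by apply: eq_bigr => i _; rewrite /be -[bump k i]/(val (lift k i)) inord_val.
have down m : (m <= k)%N -> gap_cup c be (k - m) k.+1 = gap_cup c be k k.+1.
  elim: m => [|m IH] mk; first by rewrite subn0.
  rewrite gap_cupS //; last by lia.
    by rewrite -IH ?(ltnW mk) // subnSK.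
  by have := ltn_ord k; lia.
have up m : (k + m <= n)%N -> gap_cup c be (k + m) k = gap_cup c be k k.
  elim: m => [|m IH] mk; first by rewrite addn0.
  by rewrite addnS -gap_cupS ?IH //; lia.
have kn : (k <= n)%N by rewrite -ltnS.
by rewrite -(down k) // subnn gap_cup_shift // -(up (n - k)%N) ?subnKC //.
Qed.

Lemma closed_cochain_coboundary c : closed_cochain (coboundary c).
Proof.
move=> v d d'; rewrite /coboundary (addrAC v (e d')).
have := addFF (c (v + e d)); have := addFF (c (v + e d')).
set x := c _; set y := c _; set z := c v; set t := c _ => h1 h2.
have -> : z + y + (y + t) = z + t + (y + y) by ring.
have -> : z + x + (x + t) = z + t + (x + x) by ring.
by rewrite h1 h2.
Qed.

Lemma closed_cochainD al al' : closed_cochain al -> closed_cochain al' ->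
  closed_cochain (fun v d => al v d + al' v d).
Proof. by move=> h h' v d d'; rewrite addrACA h h' addrACA. Qed.

(** The factors are changed one at a time ([h m] has the first [m] changed); by linearity each
    change adds a cup product with one exact factor, hence 0. *)
Lemma cup_cohomologous (al : 'I_n.+1 -> V -> 'I_n.+1 -> F)
    (a : 'I_n.+1 -> V -> F) : (forall i, closed_cochain (al i)) ->
  cup (fun i v d => al i v d + coboundary (a i) v d) = cup al.
Proof.
move=> cl.
pose h (m : nat) i v d := al i v d + (if (i < m)%N then coboundary (a i) v d else 0).
have hcl m i : closed_cochain (h m i).
  rewrite /h; case: (i < m)%N; last by move=> v d d'; rewrite !addr0 cl.
  by apply: closed_cochainD => //; exact: closed_cochain_coboundary.
have step m : (m <= n.+1)%N -> cup (h m) = cup al.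
  elim: m => [|m IH] mn.
    apply: eq_bigr => v _; apply: eq_bigr => s _; apply: eq_bigr => i _.
    by rewrite /h ltn0 addr0.
  rewrite -{}IH 1?ltnW //; pose k := Ordinal mn.
  pose ex i v d := if i == k then coboundary (a k) v d else h m i v d.
  suff -> : cup (h m.+1) = cup (h m) + cup ex.
    rewrite (@cup_exact ex k (a k)) ?addr0 //.
      by move=> i ik; rewrite /ex (negbTE ik); exact: hcl.
    by move=> v d; rewrite /ex eqxx.
  rewrite /cup -big_split; apply: eq_bigr => v _.
  rewrite -big_split; apply: eq_bigr => s _ /=.
  have E (b : 'I_n.+1 -> F) : \prod_i b i = b k * \prod_(i | i != k) b i.
    by rewrite (bigD1 k).
  rewrite !E [X in _ * X + _](eq_bigr (fun i => h m.+1 i (vert v s i) (s i))); last first.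
    move=> i; rewrite -val_eqE /= => ik; rewrite /h.
    by have -> : (i < m.+1)%N = (i < m)%N by lia.
  rewrite [in X in _ = _ + X](eq_bigr (fun i => h m.+1 i (vert v s i) (s i))); last first.
    move=> i ik; rewrite /ex (negbTE ik) /h; move: ik; rewrite -val_eqE /= => ik.
    by have -> : (i < m.+1)%N = (i < m)%N by lia.
  rewrite -mulrDl; congr (_ * _).
  by rewrite /h /ex eqxx /= ltnSn ltnn addr0.
rewrite -(step n.+1) //.
apply: eq_bigr => v _; apply: eq_bigr => s _; apply: eq_bigr => i _.
by rewrite /h ltn_ord.
Qed.
End TorusCells.

(** * The Poincaré-Miranda theorem *)

Section TorusGrid.
Variables (F : comNzRingType) (pcharF2 : 2%N \in [pchar F]) (n N : nat).
Local Notation V := 'rV['I_N.+2]_n.+1.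
Implicit Types (v : V) (s : 'S_n.+1).

Definition unit_step (d : 'I_n.+1) : V := \row_i (if i == d then 1 else 0).

(* The class of the k-th coordinate: it counts the edges from N+1 to 0. *)
Definition wrap_cochain (k : 'I_n.+1) v (d : 'I_n.+1) : F :=
  ((d == k) && (v 0%R k == ord_max))%:R.

Lemma vert_unit_step v s (j : nat) k : (j <= n.+1)%N ->
  vert unit_step v s j 0%R k = v 0%R k + (if (s^-1%g k < j)%N then 1 else 0).
Proof.
rewrite /vert mxE summxE => jn; congr (_ + _).
rewrite (eq_bigr (fun p : 'I_n.+1 => if p == s^-1%g k then 1 else 0)); last first.
  by move=> p _; rewrite mxE -[p == _](inj_eq (@perm_inj _ s)) permKV eq_sym.
rewrite -big_mkcondr /=; case: ifP => h.
  by rewrite (big_pred1 (s^-1%g k)) // => p /=; case: eqP => [->|]; rewrite ?h ?andbF.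
by rewrite big_pred0 // => p; case: eqP => [->|]; rewrite ?h ?andbF.
Qed.

Lemma closed_cochain_wrap_cochain k : closed_cochain unit_step (wrap_cochain k).
Proof.
move=> v d d'; rewrite /wrap_cochain !mxE.
have [_|_] := eqVneq d k; have [_|_] := eqVneq d' k; rewrite /= ?addr0 ?add0r //.
Qed.

(** Factor [k] forces [s k = k] and coordinate [k] of [v] to be [N+1], so exactly one cell
    contributes. *)
Lemma cup_wrap_cochain : cup unit_step wrap_cochain = 1.
Proof.
rewrite /cup (bigD1 (const_mx ord_max)) //= (bigD1 1%g) //= big1 => [|i _]; last first.
  rewrite /wrap_cochain perm1 eqxx vert_unit_step ?(ltnW (ltn_ord i)) // invg1 perm1 ltnn.
  by rewrite addr0 mxE eqxx.
rewrite !big1 ?addr0 // => [v vN | s s1].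
  rewrite big1 // => s _.
  have [k vk] : exists k, v 0%R k != ord_max.
    apply/existsP; apply: contraNT vN; rewrite negb_exists => /forallP h.
    by apply/eqP/rowP => i; rewrite mxE; apply/eqP; have := h i; rewrite negbK.
  rewrite (bigD1 k) //= /wrap_cochain; case: eqP => [sk|]; last by rewrite mul0r.
  have sk' : s^-1%g k = k by rewrite -{1}sk permK.
  rewrite vert_unit_step ?(ltnW (ltn_ord k)) // sk' ltnn addr0.
  by rewrite (negbTE vk) mul0r.
have [k sk] : exists k, s k != k.
  apply/existsP; apply: contraNT s1; rewrite negb_exists => /forallP h.
  by apply/eqP/permP => i; rewrite perm1; apply/eqP; have := h i; rewrite negbK.
by rewrite (bigD1 k) //= /wrap_cochain (negbTE sk) mul0r.
Qed.

(** Here [a k] stands for the sign of the k-th component. The cup product of the modified cochains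
    is still 1, so on some cell no factor vanishes. That cell does not wrap around, hence its k-th
    factor is nonzero only because [a k] changes along its k-th edge. *)
Lemma discrete_poincare_miranda_char2 (a : 'I_n.+1 -> V -> bool) :
  (forall k v, v 0%R k = ord0 -> ~~ a k v) -> (forall k v, v 0%R k = ord_max -> a k v) ->
  exists2 v : V, forall j, (v 0%R j < N.+1)%N & forall k, exists u w : V,
    [/\ forall j, (v 0%R j <= u 0%R j <= (v 0%R j).+1)%N,
       forall j, (v 0%R j <= w 0%R j <= (v 0%R j).+1)%N,
       ~~ a k u & a k w].
Proof.
move=> a0 a1.
(* Adding the coboundary of [a] makes the cochains vanish on the wrapping cells. *)
pose A k v : F := (a k v)%:R.
have := cup_cohomologous pcharF2 A closed_cochain_wrap_cochain.
set al := fun (i : 'I_n.+1) v d => _.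
rewrite cup_wrap_cochain => cup1.
have [v [s h]] : exists v s, forall i, al i (vert unit_step v s i) (s i) != 0.
  have [/existsP[v /existsP[s /forallP h]]|] := boolP
    [exists v, exists s : 'S_n.+1, forall i, al i (vert unit_step v s i) (s i) != 0].
    by exists v, s.
  rewrite negb_exists => /forallP h; move/eqP: cup1; rewrite eq_sym /cup big1 ?oner_eq0 // => v _.
  rewrite big1 // => s _; have := h v; rewrite negb_exists => /forallP/(_ s).
  rewrite negb_forall => /existsP[i]; rewrite negbK => /eqP hi.
  by rewrite (bigD1 i) //= hi mul0r.
have F2 : 1 + 1 = 0 :> F by exact: addrr_pchar2.
(* If coordinate [k] of [v] were [N+1], factor [k] would vanish. When [s k = k], its edge goes from
   [N+1] to 0 and both summands are 1. Otherwise both ends have the same k-th coordinate, 0 or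
   [N+1], so [a k] agrees there and both summands are 0. *)
have vlt k : (v 0%R k < N.+1)%N.
  rewrite ltnNge; apply/negP => Nv.
  have vk : v 0%R k = ord_max by apply: val_inj; apply/eqP; rewrite /= eqn_leq Nv -ltnS ltn_ord.
  have M1 : ord_max + 1 = 0 :> 'I_N.+2.
    by apply: val_inj; rewrite /= addn1 modnn.
  have := h k; rewrite /al /wrap_cochain /coboundary; set u := vert _ _ _ _.
  have uk : u 0%R k = ord_max + (if (s^-1%g k < k)%N then 1 else 0).
    by rewrite /u vert_unit_step ?vk // ltnW.
  have u1k : (u + unit_step (s k)) 0%R k = u 0%R k + (if k == s k then 1 else 0) by rewrite !mxE.
  rewrite -(inj_eq (@perm_inj _ s^-1%g)) permK in u1k.
  have -> : (s k == k) = (s^-1%g k == k).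
    by rewrite -(inj_eq (@perm_inj _ s^-1%g)) permK eq_sym.
  move: uk u1k; case: eqP => sk /=.
    rewrite sk ltnn addr0 => uk; rewrite uk M1 eqxx => u1.
    by rewrite /A (negbTE (a0 _ _ u1)) (a1 _ _ uk) addr0 F2 eqxx.
  case: ifP => _; rewrite !addr0 ?M1 => uk; rewrite uk => u1; rewrite add0r /A.
    by rewrite (negbTE (a0 _ _ u1)) (negbTE (a0 _ _ uk)) addr0 eqxx.
  by rewrite (a1 _ _ u1) (a1 _ _ uk) F2 eqxx.
have vertE (r : nat) j : (r <= n.+1)%N ->
    (v 0%R j <= vert unit_step v s r 0%R j <= (v 0%R j).+1)%N.
  move=> rn; rewrite vert_unit_step //; have := vlt j.
  case: ifP => _ vj; last by rewrite addr0 leqnn leqnSn.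
  by rewrite /= modn_small addn1 ?ltnS // leqnn leqnSn.
exists v => // k.
have := h k; rewrite /al /coboundary -vertS.
have kn : (k <= n.+1)%N by rewrite ltnW.
have kn1 : (k < n.+1)%N by [].
have -> : wrap_cochain k (vert unit_step v s k) (s k) = 0.
  rewrite /wrap_cochain; case: eqP => //= sk.
  have sk' : s^-1%g k = k by rewrite -{1}sk permK.
  rewrite vert_unit_step // sk' ltnn addr0 -val_eqE /=.
  by rewrite (ltn_eqF (vlt k)).
rewrite add0r /A.
case E1: (a k _); case E2: (a k _) => //; rewrite ?F2 ?addr0 ?eqxx // => _.
- exists (vert unit_step v s k.+1), (vert unit_step v s k).
  by split => [j|j||//]; rewrite ?vertE // E2.
- exists (vert unit_step v s k), (vert unit_step v s k.+1).
  by split => [j|j||//]; rewrite ?vertE // E1.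
Qed.
End TorusGrid.

Lemma discrete_poincare_miranda n N (a : 'I_n.+1 -> 'rV['I_N.+2]_n.+1 -> bool) :
  (forall k (v : 'rV['I_N.+2]_n.+1), v 0%R k = ord0 -> ~~ a k v) ->
  (forall k (v : 'rV['I_N.+2]_n.+1), v 0%R k = ord_max -> a k v) ->
  exists2 v : 'rV['I_N.+2]_n.+1, forall j, (v 0%R j < N.+1)%N &
  forall k, exists u w : 'rV['I_N.+2]_n.+1,
    [/\ forall j, (v 0%R j <= u 0%R j <= (v 0%R j).+1)%N,
       forall j, (v 0%R j <= w 0%R j <= (v 0%R j).+1)%N,
       ~~ a k u & a k w].
Proof. by apply: (@discrete_poincare_miranda_char2 'F_2); rewrite pchar_Fp. Qed.

(** * From the grid to approximate zeros of Lipschitz maps on a cube *)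

Lemma le_coord_rV_norm (R : realType) n (x : 'rV[R]_n) i : `|x 0 i| <= `|x|.
Proof.
by rewrite [leRHS]/Num.norm /= mx_normrE; apply: (le_bigmax _ _ (0, i)).
Qed.

Lemma rV_norm_le (R : realType) n (x : 'rV[R]_n) (c : R) : 0 <= c ->
  (forall i, `|x 0 i| <= c) -> `|x| <= c.
Proof.
move=> c0 h; rewrite [leLHS]/Num.norm /= mx_normrE; apply: bigmax_le => //.
by move=> [i j] _ /=; rewrite ord1.
Qed.

(** The bound on [F x - x] yields the usual sign conditions on opposite faces. An approximate zero
    is enough for the later contradiction, so no limit of grids is taken. *)
Lemma poincare_miranda (R : realType) n (F : 'rV[R]_n.+1 -> 'rV[R]_n.+1) (r L e : R) :
  0 < r -> 0 <= L -> 0 < e ->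
  (forall x y, `|x| <= r -> `|y| <= r -> `|F x - F y| <= L * `|x - y|) ->
  (forall x, `|x| <= r -> `|F x - x| <= r) ->
  exists2 x, `|x| <= r & `|F x| <= e.
Proof.
move=> r0 L0 e0 lipF Fr.
(* The mesh [h] is fine enough that [F] varies by at most [e] over a grid cell. *)
pose N := Num.truncn (2 * r * L / e); pose h := 2 * r / N.+1%:R.
have h0 : 0 < h by rewrite divr_gt0 // mulr_gt0.
have hN : h * N.+1%:R = 2 * r by rewrite mulfVK.
have Lh : L * h <= e.
  rewrite /h mulrA ler_pdivrMr // -ler_pdivrMl // [_ * (L * _)]mulrC.
  by rewrite (mulrC L) ltW // truncnS_gt.
pose pt (v : 'rV['I_N.+2]_n.+1) : 'rV[R]_n.+1 := \row_i (h * (v 0 i)%:R - r).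
have ptr v : `|pt v| <= r.
  apply: rV_norm_le => [|i]; first exact: ltW.
  have vN : (v 0 i)%:R <= N.+1%:R :> R by rewrite ler_nat -ltnS.
  have v0 : 0 <= (v 0 i)%:R :> R by [].
  have := ler_wpM2l (ltW h0) vN; have := mulr_ge0 (ltW h0) v0.
  rewrite hN mxE ler_norml => *; lra.
have pt_dist (u v : 'rV['I_N.+2]_n.+1) :
    (forall j, (v 0%R j <= u 0%R j <= (v 0%R j).+1)%N) -> `|pt u - pt v| <= h.
  move=> uv; apply: rV_norm_le => [|i]; first exact: ltW.
  have /andP[] := uv i; rewrite -!(ler_nat R) -natr1 !mxE => vu uv1.
  have := ler_wpM2l (ltW h0) vu; have := ler_wpM2l (ltW h0) uv1.
  by rewrite mulrDr mulr1 ler_norml => *; lra.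
(* On the two extreme faces the value is prescribed, since [F] may vanish there and its sign would
   not decide. *)
pose a k (v : 'rV['I_N.+2]_n.+1) :=
  (v 0 k == ord_max) || (v 0 k != ord0) && (0 < F (pt v) 0 k).
have FE v k : `|F (pt v) 0 k - pt v 0 k| <= r.
  by have := le_trans (le_coord_rV_norm (F (pt v) - pt v) k) (Fr _ (ptr v)); rewrite !mxE.
have [k v v0|k v vN|v _ vk] := @discrete_poincare_miranda n N a.
- by rewrite /a v0.
- by rewrite /a vN eqxx.
exists (pt v) => //; apply: rV_norm_le => [|k]; first exact: ltW.
have close (u : 'rV['I_N.+2]_n.+1) : (forall j, (v 0%R j <= u 0%R j <= (v 0%R j).+1)%N) ->
    `|F (pt u) 0 k - F (pt v) 0 k| <= e.
  move=> uv; have := le_coord_rV_norm (F (pt u) - F (pt v)) k; rewrite !mxE => hh.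
  apply: (le_trans hh); apply: (le_trans (lipF _ _ (ptr _) (ptr _))).
  by apply: le_trans Lh; rewrite ler_wpM2l // pt_dist.
have [u [w [/close + /close + au aw]]] := vk k.
have Fu : F (pt u) 0 k <= 0.
  move: au; rewrite /a negb_or negb_and negbK -leNgt => /andP[_ /orP[/eqP u0|//]].
  by have := FE u k; rewrite [pt u 0 k]mxE u0 mulr0 ler_norml => *; lra.
have Fw : 0 <= F (pt w) 0 k.
  move: aw; rewrite /a => /orP[/eqP u0|/andP[_ /ltW//]].
  by have := FE w k; rewrite [pt w 0 k]mxE u0 /= hN ler_norml => *; lra.
by rewrite !ler_norml => *; lra.
Qed.

(* Counting: the sphere is covered by O(K^n) small sets, whereas there are
   K^(n+1) candidates for w, each excluded set being hit by at most one. *)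
Lemma lipschitz_sphere_avoid (R : realType) n (G : 'rV[R]_n.+1 -> 'rV[R]_n.+1)
    (L eps dl : R) : 0 <= L -> 0 < eps -> 0 < dl ->
  (forall y z, `|G y - G z| <= L * `|y - z|) ->
  exists w, `|w| <= dl /\
    exists2 eta, 0 < eta & forall y, `|y| = eps -> eta <= `|G y - w|.
Proof.
move=> L0 eps0 dl0 lipG.
(* Each face is cut into [N = C * K] intervals per axis and the candidates [w] have spacing
   [d = dl / K]. The choice of [C] gives [L * h <= d / 4]; that of [K] makes [K^(n+1)] exceed the
   number of net points, at most [2 (n+1) (2 C K)^n]. *)
pose C := (Num.truncn (8 * L * eps / dl)).+1.
have CL : 8 * L * eps <= C%:R * dl by rewrite -ler_pdivrMr // ltW // truncnS_gt.
pose K := (n.+1 * 2 * (2 * C) ^ n).+1; pose N := (C * K)%N.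
have N0 : 0 < N%:R :> R by rewrite ltr0n muln_gt0.
have K0 : 0 < K%:R :> R by rewrite ltr0n.
pose h := 2 * eps / N%:R.
have h0 : 0 < h by rewrite divr_gt0 // mulr_gt0.
have hN : h * N%:R = 2 * eps by rewrite mulfVK // gt_eqF.
pose d := dl / K%:R.
have d0 : 0 < d by rewrite divr_gt0.
have dK : d * K%:R = dl by rewrite mulfVK // gt_eqF.
have Lh : L * h <= d / 4.
  rewrite -(ler_pM2r N0) -mulrA hN.
  have -> : d / 4 * N%:R = d * K%:R * C%:R / 4 by rewrite /N natrM; ring.
  by rewrite dK; lra.
pose P : finType := {ffun 'I_n.+1 -> 'I_K}.
(* A net point on the boundary of the cube: the fixed coordinate, its sign, and a grid point of that
   face. *)
pose I : finType := ('I_n.+1 * bool * {ffun 'I_n -> 'I_N.+1})%type.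
pose w (p : P) : 'rV[R]_n.+1 := \row_i (d * (p i)%:R).
pose z (q : I) : 'rV[R]_n.+1 := \row_j
  if unlift q.1.1 j is Some j' then h * (q.2 j')%:R - eps
  else if q.1.2 then eps else - eps.
have wdl p : `|w p| <= dl.
  apply: rV_norm_le => [|i]; first exact: ltW.
  rewrite mxE ger0_norm; last by rewrite mulr_ge0 // ltW.
  by rewrite -dK (ler_pM2l d0) ler_nat ltnW.
have near_z y : `|y| = eps -> exists q, `|y - z q| <= h.
  move=> yeps.
  have yi i : - eps <= y 0 i <= eps by rewrite -ler_norml -yeps le_coord_rV_norm.
  have [[i0 i] /=] : exists i, `|y| = `|y i.1 i.2|.
    by apply: mx_norm_neq0; rewrite -[mx_norm y]/(`|y|) yeps gt_eqF.
  rewrite (ord1 i0) => {i0} yieps.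
  have fl j : exists k : 'I_N.+1, `|y 0 j - (h * k%:R - eps)| <= h.
    have /andP[y1 y2] := yi j.
    have x0 : 0 <= (y 0 j + eps) / h by rewrite divr_ge0 ?(ltW h0) //; lra.
    have /andP[t1 t2] := truncn_itv x0.
    have tN : (Num.truncn ((y 0%R j + eps) / h)%R < N.+1)%N.
      rewrite ltnS -(ler_nat R); apply: (le_trans t1).
      by rewrite ler_pdivrMr // mulrC hN; lra.
    exists (Ordinal tN) => /=.
    move: t1 t2; rewrite ler_pdivlMr // ltr_pdivrMr // -[_.+1%:R]natr1.
    by set t := _%:R; rewrite (mulrC h) ler_norml => *; lra.
  have /choice[k kP] := fl.
  exists (i, 0 <= y 0 i, [ffun j => k (lift i j)]); apply: rV_norm_le => [|j]; first exact: ltW.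
  rewrite !mxE /=; case: unliftP => [j' ->|->]; first by rewrite ffunE.
  rewrite -yeps yieps; case: (leP 0 (y 0 i)) => y0.
    by rewrite (ger0_norm y0) subrr normr0 ltW.
  by rewrite (ltr0_norm y0) opprK subrr normr0 ltW.
apply: contrapT => noW.
have bad p : exists q, `|G (z q) - w p| < d / 2.
  apply: contrapT => noq; apply: noW; exists (w p); split=> //.
  exists (d / 4); first by rewrite divr_gt0.
  move=> y /near_z[q yq]; rewrite leNgt; apply/negP => lt4; apply: noq; exists q.
  have := ler_distD (G y) (G (z q)) (w p); have := lipG (z q) y.
  have := ler_wpM2l L0 yq; rewrite [`|z q - y|]distrC => *; lra.
have /choice[b bP] := bad.
(* Two distinct candidates are at least [d] apart, so they cannot both lie within [d / 2] of the
   same net image. *)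
have b_inj : injective b.
  move=> p p' bpp; apply/ffunP => i; apply/val_inj/eqP/negPn/negP => pp.
  have : `|w p - w p'| < d.
    have := ler_distD (G (z (b p))) (w p) (w p'); have := bP p; have := bP p'.
    by rewrite -bpp [`|w p - G _|]distrC => *; lra.
  apply/negP; rewrite -leNgt; apply: le_trans (le_coord_rV_norm _ i).
  rewrite !mxE -mulrBr normrM (gtr0_norm d0) ler_peMr ?(ltW d0) //.
  have : (1 : R) <= (`|(p i)%:Z - (p' i)%:Z|%R)%:~R.
    by rewrite -[1]/(1%:~R) ler_int -gtz0_ge1 normr_gt0 subr_eq0.
  by rewrite intr_norm rmorphB.
have := leq_card b b_inj; rewrite !card_prod !card_ffun !card_ord card_bool.
apply/negP; rewrite -ltnNge.
have CK1 : (1 <= C * K)%N by rewrite muln_gt0.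
have le1 : (N.+1 ^ n <= (2 * C) ^ n * K ^ n)%N.
  have expn_le k a c : (a <= c)%N -> (a ^ k <= c ^ k)%N.
    by case: k => // k; rewrite leq_exp2r.
  by rewrite -expnMn; apply: expn_le; rewrite /N -mulnA; lia.
apply: leq_ltn_trans (_ : n.+1 * 2 * (2 * C) ^ n * K ^ n < _)%N.
  by rewrite -(mulnA (n.+1 * 2)) leq_mul2l le1 orbT.
by rewrite expnS ltn_pmul2r // expn_gt0.
Qed.

(** * Zeros of bi-Lipschitz maps *)

(** The extension is the infimum over [Q] of the cones [u x + L |y - f x|]. Writing the data along
    [f] makes it extend an inverse of [f] when [u] is a coordinate. *)
Lemma mcshane_extension (R : realType) (T : Type) (V : normedModType R)
    (Q : set T) (u : T -> R) (f : T -> V) (L : R) : Q !=set0 -> 0 <= L ->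
  (forall x y, Q x -> Q y -> `|u x - u y| <= L * `|f x - f y|) ->
  exists2 G : V -> R, forall x, Q x -> G (f x) = u x &
    forall y z, `|G y - G z| <= L * `|y - z|.
Proof.
move=> [x0 Qx0] L0 lipu.
pose E y := [set u x + L * `|y - f x| | x in Q].
have En y : E y !=set0 by exists (u x0 + L * `|y - f x0|), x0.
have Elb y : has_lbound (E y).
  exists (u x0 - L * `|y - f x0|) => _ [x Qx <-].
  have := lipu x0 x Qx0 Qx; have := ler_wpM2l L0 (ler_distD y (f x0) (f x)).
  by rewrite mulrDr [`|f x0 - y|]distrC ler_norml => *; lra.
have infE y z : inf (E y) <= inf (E z) + L * `|y - z|.
  rewrite -lerBlDr; apply: lb_le_inf => // _ [x Qx <-].
  have := ge_inf (Elb y) (ex_intro2 _ _ x Qx erefl).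
  by have := ler_wpM2l L0 (ler_distD z y (f x)); rewrite mulrDr => *; lra.
exists (fun y => inf (E y)) => [x Qx|y z].
  apply/eqP; rewrite eq_le; apply/andP; split.
    have := ge_inf (Elb (f x)) (ex_intro2 _ _ x Qx erefl).
    by rewrite subrr normr0 mulr0 addr0.
  apply: lb_le_inf => // _ [y Qy <-].
  by have := lipu x y Qx Qy; rewrite ler_norml => *; lra.
have := infE y z; have := infE z y.
by rewrite [`|z - y|]distrC ler_norml => *; lra.
Qed.

(** * Radial projection out of a small cube *)

Section PushOut.
Variables (R : realType) (V : normedModType R) (eps : R).
Hypothesis eps0 : 0 < eps.
Implicit Types y z : V.

(** The maximum merges the identity outside the ball of radius [eps] with the projection onto its
    boundary inside. The value at 0 is the meaningless 0. *)
Definition push_out y : V := Num.max 1 (eps / `|y|) *: y.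

Lemma push_out_id y : eps <= `|y| -> push_out y = y.
Proof.
move=> h; rewrite /push_out max_l ?scale1r // ler_pdivrMr ?mul1r //.
exact: lt_le_trans h.
Qed.

Lemma push_out_scale y : y != 0 -> `|y| <= eps -> push_out y = (eps / `|y|) *: y.
Proof.
by move=> y0 h; rewrite /push_out max_r // ler_pdivlMr ?mul1r // normr_gt0.
Qed.

Lemma norm_push_out y : y != 0 -> `|y| <= eps -> `|push_out y| = eps.
Proof.
move=> y0 h; rewrite push_out_scale // normrZ normrM normfV normr_id.
by rewrite mulfVK ?normr_eq0 // gtr0_norm.
Qed.

Lemma push_out_dist y : y != 0 -> `|push_out y - y| <= eps.
Proof.
move=> y0; have [h|h] := leP eps `|y|.
  by rewrite push_out_id // subrr normr0 ltW.
rewrite push_out_scale ?(ltW h) //.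
have -> : (eps / `|y|) *: y - y = (eps / `|y| - 1) *: y by rewrite scalerBl scale1r.
rewrite normrZ.
have yp : 0 < `|y| by rewrite normr_gt0.
have -> : eps / `|y| - 1 = (eps - `|y|) / `|y| by rewrite mulrBl mulfV // gt_eqF.
rewrite normrM normfV normr_id mulfVK ?gt_eqF // gtr0_norm ?subr_gt0 //.
by rewrite gerBl.
Qed.

(** The scaling factor is at most [1 + eps / rho], and its variation, weighted by the norm of [z],
    contributes another [eps / rho]. *)
Lemma push_out_lipschitz rho y z : 0 < rho -> rho <= `|y| -> rho <= `|z| ->
  `|push_out y - push_out z| <= (1 + 2 * eps / rho) * `|y - z|.
Proof.
move=> r0 ry rz.
have y0 : 0 < `|y| := lt_le_trans r0 ry; have z0 : 0 < `|z| := lt_le_trans r0 rz.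
have max_dist (s t : R) : `|Num.max 1 s - Num.max 1 t| <= `|s - t|.
  by case: (leP 1 s); case: (leP 1 t); case: (ger0P (s - t)) => *; rewrite ?ler_norml; lra.
have -> : push_out y - push_out z = Num.max 1 (eps / `|y|) *: (y - z) +
    (Num.max 1 (eps / `|y|) - Num.max 1 (eps / `|z|)) *: z.
  by rewrite /push_out scalerBr scalerBl addrA subrK.
apply: (le_trans (ler_normD _ _)); rewrite !normrZ.
have h1 : `|Num.max 1 (eps / `|y|)| <= 1 + eps / rho.
  have e1 : eps / `|y| <= eps / rho by rewrite ler_pM2l // lef_pV2.
  have e2 : 0 < eps / rho by rewrite divr_gt0.
  have e3 : 0 < eps / `|y| by rewrite divr_gt0.
  by case: (leP 1 (eps / `|y|)) => *; rewrite ger0_norm; lra.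
have h2 : `|Num.max 1 (eps / `|y|) - Num.max 1 (eps / `|z|)| * `|z| <= eps / rho * `|y - z|.
  apply: (le_trans (ler_wpM2r (ltW z0) (max_dist _ _))).
  have -> : eps / `|y| - eps / `|z| = eps / `|y| * (`|z| - `|y|) / `|z|.
    by field; rewrite !gt_eqF.
  rewrite [in leLHS]normrM normfV normr_id mulfVK ?gt_eqF // normrM.
  rewrite ger0_norm; last by rewrite divr_ge0 ?ltW.
  apply: ler_pM => //; first by rewrite divr_ge0 ?ltW.
    by rewrite ler_pM2l // lef_pV2.
  by rewrite distrC [in leRHS]distrC -[in leRHS]distrC ler_dist_dist.
have := ler_wpM2r (normr_ge0 (y - z)) h1.
have -> : 1 + 2 * eps / rho = (1 + eps / rho) + eps / rho by ring.
by rewrite (mulrDl (1 + eps / rho)) => *; lra.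
Qed.
End PushOut.

Lemma compact_closed_ball_rV (R : realType) n (r : R) :
  compact [set x : 'rV[R]_n | `|x| <= r].
Proof.
apply: bounded_closed_compact.
  exists r; split; first exact: num_real.
  by move=> M rM x /= xr; apply: le_trans xr (ltW rM).
rewrite (_ : [set x | _] = closed_ball_ Num.norm 0 r); first exact: closed_closed_ball_.
by apply/seteqP; split=> x; rewrite /closed_ball_ /= sub0r normrN.
Qed.

Lemma bilipschitz_zero_centered (R : realType) n (f : 'rV[R]_n.+1 -> 'rV[R]_n.+1)
    (r K M : R) : 0 < r -> 0 < K -> 0 < M ->
  (forall x y, `|x| <= r -> `|y| <= r -> K * `|x - y| <= `|f x - f y|) ->
  (forall x y, `|x| <= r -> `|y| <= r -> `|f x - f y| <= M * `|x - y|) ->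
  `|f 0| <= K * r / 4 -> exists2 x, `|x| <= r & f x = 0.
Proof.
move=> r0 K0 M0 fK fM f0; apply: contrapT => nozero.
have Q0 : `|0 : 'rV[R]_n.+1| <= r by rewrite normr0 ltW.
have [rho rho0 f_rho] : exists2 rho, 0 < rho & forall x, `|x| <= r -> rho <= `|f x|.
  have [|||c + cmin] := @EVT_min_rV R n.+1 (fun x => `|f x|) [set x | `|x| <= r].
  - by exists 0.
  - exact: compact_closed_ball_rV.
  - apply/subspace_continuousP => x /= xr; apply/cvgrPdist_le => e e0.
    near=> y; have yr : `|y| <= r by near: y; exact: withinT.
    apply: (le_trans (ler_dist_dist _ _)); apply: (le_trans (fM _ _ xr yr)).
    rewrite -ler_pdivlMl //; near: y; apply: cvg_within.
    have Me0 : 0 < M^-1 * e by rewrite mulr_gt0 // invr_gt0.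
    rewrite -/(nbhs x (fun z : 'rV[R]_n.+1 => `|x - z| <= M^-1 * e)).
    by apply/nbhs_ballP; exists (M^-1 * e) => // z; rewrite -ball_normE /=; exact: ltW.
  rewrite inE /= => cr; exists `|f c|.
    by rewrite normr_gt0; apply/eqP => fc; apply: nozero; exists c.
  by move=> x xr; apply: cmin; rewrite inE.
have Ki0 : 0 <= K^-1 by rewrite invr_ge0 ltW.
(* Extending each coordinate separately keeps the constant [K^-1], the norm being the sup norm. *)
have [G GE lipG] : exists2 G : 'rV[R]_n.+1 -> 'rV[R]_n.+1,
    forall x, `|x| <= r -> G (f x) = x & forall y z, `|G y - G z| <= K^-1 * `|y - z|.
  have /choice[g gP] : forall i, exists g : 'rV[R]_n.+1 -> R,
      (forall x, `|x| <= r -> g (f x) = x 0 i) /\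
      (forall y z, `|g y - g z| <= K^-1 * `|y - z|).
    move=> i; have [|//|x y xr yr|g g1 g2] := @mcshane_extension R _ _
      [set x : 'rV[R]_n.+1 | `|x| <= r] (fun x => x 0 i) f K^-1; last by exists g.
    - by exists 0.
    - rewrite ler_pdivlMl //; apply: le_trans (fK x y xr yr).
      rewrite ler_pM2l //; have := le_coord_rV_norm (x - y) i; by rewrite !mxE.
  exists (fun y => \row_i g i y) => [x xr|y z].
    by apply/rowP => i; rewrite mxE (gP i).1.
  apply: rV_norm_le => [|i]; first by rewrite mulr_ge0.
  by rewrite !mxE (gP i).2.
(* With this [eps], pushing out moves [G] by at most [r / 2], which with [dl <= r / 2] gives the
   face condition. Since the bound on [f 0] is [eps / 2], the other bound on [dl] keeps [f w] within
   [3 eps / 4], short of [eps]. *)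
pose eps := K * r / 2.
have eps0 : 0 < eps by rewrite divr_gt0 // mulr_gt0.
pose dl := Num.min (r / 2) (eps / (4 * M)).
have dl0 : 0 < dl by rewrite lt_min !divr_gt0 // mulr_gt0.
have dlr : dl <= r / 2 by rewrite ge_min lexx.
have dlM : M * dl <= eps / 4.
  have : dl <= eps / (4 * M) by rewrite ge_min lexx orbT.
  by rewrite ler_pdivlMr ?mulr_gt0 // => *; lra.
have [w [wdl [eta eta0 Gw]]] := lipschitz_sphere_avoid Ki0 eps0 dl0 lipG.
pose F x := G (push_out eps (f x)) - w.
have fx0 x : `|x| <= r -> f x != 0.
  by move=> /f_rho h; rewrite -normr_gt0 (lt_le_trans rho0).
pose L := K^-1 * ((1 + 2 * eps / rho) * M).
have L0 : 0 <= L.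
  by rewrite !mulr_ge0 ?(ltW M0) // addr_ge0 // divr_ge0 ?(ltW rho0) // mulr_ge0 ?(ltW eps0).
pose e := Num.min (eta / 2) (eps / (8 * M)).
have e0 : 0 < e by rewrite lt_min !divr_gt0 // mulr_gt0.
have [x y xr yr|x xr|x xr Fx] := @poincare_miranda R n F r L e r0 L0 e0.
- rewrite /F opprB addrA subrK; apply: (le_trans (lipG _ _)).
  rewrite /L -(mulrA K^-1) ler_wpM2l // -(mulrA (1 + _)).
  apply: (le_trans (push_out_lipschitz eps0 rho0 (f_rho x xr) (f_rho y yr))).
  rewrite ler_wpM2l ?fM // addr_ge0 // divr_ge0 ?(ltW rho0) // mulr_ge0 ?(ltW eps0) //.
- rewrite /F -{2}(GE x xr) addrAC.
  apply: (le_trans (ler_normB _ _)).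
  have h : K^-1 * `|push_out eps (f x) - f x| <= r / 2.
    rewrite ler_pdivrMl //; apply: (le_trans (push_out_dist eps0 (fx0 _ xr))).
    by rewrite /eps mulrA.
  by have := le_trans (lipG _ _) h; lra.
have wr : `|w| <= r by lra.
move: Fx; apply/negP; rewrite -ltNge /F.
(* If [f x] is inside the cube, it is pushed to the boundary, whose image stays [eta] away from [w].
   Otherwise [F x = x - w], and [f x] and [f w] differ by at least [eps / 4]. *)
have [h|h] := leP eps `|f x|; last first.
  apply: lt_le_trans (Gw _ (norm_push_out eps0 (fx0 _ xr) (ltW h))).
  by apply: le_lt_trans (_ : eta / 2 < _); [rewrite ge_min lexx|lra].
rewrite push_out_id // GE //.
have fw : `|f w| <= eps / 4 + eps / 2.
  have := fM w 0 wr Q0; rewrite subr0.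
  have := ler_wpM2l (ltW M0) wdl; have := ler_distD 0 (f w) (f 0).
  have := ler_normD (f w - f 0) (f 0); rewrite subrK.
  have : eps / 2 = K * r / 4 by rewrite /eps; field.
  by move=> *; lra.
have : eps / 4 <= M * `|x - w|.
  apply: le_trans (fM x w xr wr).
  by have := ler_normD (f x - f w) (f w); rewrite subrK => *; lra.
rewrite -ler_pdivrMl // => hx; apply: lt_le_trans hx.
apply: le_lt_trans (_ : eps / (8 * M) < _); first by rewrite ge_min lexx orbT.
have -> : M^-1 * (eps / 4) = eps / (8 * M) * 2 by field; rewrite gt_eqF.
have : 0 < eps / (8 * M) by rewrite divr_gt0 // mulr_gt0.
by move=> *; lra.
Unshelve. all: by end_near. Qed.

(** * The implicit function theorem *)

Lemma bilipschitz_zero (R : realType) n (f : 'rV[R]_n -> 'rV[R]_n)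
    (b : 'rV[R]_n) (r K M : R) : 0 < r -> 0 < K -> 0 < M ->
  (forall x y, `|x - b| <= r -> `|y - b| <= r -> K * `|x - y| <= `|f x - f y|) ->
  (forall x y, `|x - b| <= r -> `|y - b| <= r -> `|f x - f y| <= M * `|x - y|) ->
  `|f b| <= K * r / 4 -> exists2 x, `|x - b| <= r & f x = 0.
Proof.
(* The grid argument needs positive dimension; in dimension 0 every vector is 0. *)
case: n f b => [|n] f b r0 K0 M0 fK fM fb.
  by exists b; [rewrite subrr normr0 ltW|apply/rowP; case].
have [x y xr yr|x y xr yr||x xr fx] :=
    @bilipschitz_zero_centered R n (fun x => f (x + b)) r K M r0 K0 M0.
- by have := fK (x + b) (y + b); rewrite !addrK opprD addrACA subrr addr0; apply.
- by have := fM (x + b) (y + b); rewrite !addrK opprD addrACA subrr addr0; apply.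
- by rewrite add0r.
- by exists (x + b); rewrite ?addrK.
Qed.

Lemma rV_norm_le_enorm (R : realType) n (x : 'rV[R]_n) : `|x| <= enorm x.
Proof.
apply: rV_norm_le => [|i]; first exact: sqrtr_ge0.
rewrite -sqrtr_sqr /enorm ler_sqrt; last by rewrite sumr_ge0 // => j _; exact: sqr_ge0.
by rewrite (bigD1 i) //= lerDl sumr_ge0 // => j _; exact: sqr_ge0.
Qed.

(** The crude factor [n+1] replaces the square root of [n] and stays positive for [n = 0], so it can
    be divided by. *)
Lemma enorm_le_rV_norm (R : realType) n (x : 'rV[R]_n) : enorm x <= n.+1%:R * `|x|.
Proof.
have nx0 : 0 <= n.+1%:R * `|x| by rewrite mulr_ge0.
rewrite -(ger0_norm nx0) -sqrtr_sqr /enorm ler_sqrt ?sqr_ge0 //.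
apply: (@le_trans _ _ (\sum_(i < n) `|x| ^+ 2)).
  apply: ler_sum => i _; rewrite -[leLHS]real_normK ?num_real //.
  by rewrite lerXn2r ?nnegrE // le_coord_rV_norm.
rewrite sumr_const card_ord -[leLHS]mulr_natl exprMn ler_wpM2r ?sqr_ge0 //.
by rewrite -natrX ler_nat; nia.
Qed.

Theorem theorem5 (R : realType) (m n : nat)
  (U : set (R * 'rV[R]_m)) (Un : set 'rV[R]_n)
  (a : R * 'rV[R]_m) (b : 'rV[R]_n)
  (f : (R * 'rV[R]_m) * 'rV[R]_n -> 'rV[R]_n)
  (openU : open U) (openUn : open Un)
  (Ua : U a) (Unb : Un b)
  (fab0 : f (a, b) = 0)
  (f_holder : exists2 M : R, 0 < M &
    forall (t s : R) (x z : 'rV[R]_m) (y w : 'rV[R]_n),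
      U (t, x) -> U (s, z) -> Un y -> Un w ->
      enorm (f (t, x, y) - f (s, z, w)) <=
        M * (enorm (x - z) + Num.sqrt `|t - s| + enorm (y - w)))
  (f_lower : exists2 K : R, 0 < K &
    forall (t : R) (x : 'rV[R]_m) (y w : 'rV[R]_n),
      U (t, x) -> Un y -> Un w ->
      K * enorm (y - w) <= enorm (f (t, x, y) - f (t, x, w))) :
  exists (V : set (R * 'rV[R]_m)) (phi : R * 'rV[R]_m -> 'rV[R]_n) (M' : R),
    [/\ open V, V a & V `<=` U] /\
    [/\ (forall p, V p -> Un (phi p)),
        0 < M',
        (forall (t s : R) (x z : 'rV[R]_m), V (t, x) -> V (s, z) ->
          enorm (phi (t, x) - phi (s, z)) <=
            M' * (enorm (x - z) + Num.sqrt `|t - s|)) &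
        [set q | (V `*` Un) q /\ f q = 0] = [set (p, phi p) | p in V]].
Proof.
case: a Ua fab0 => t0 x0 Ua fab0.
have [M M0 fM] := f_holder; have [K K0 fK] := f_lower.
have enorm0 k : enorm (0 : 'rV[R]_k) = 0.
  by rewrite /enorm big1 ?sqrtr0 // => i _; rewrite mxE expr0n.
have enorm_eq0 k (x : 'rV[R]_k) : enorm x <= 0 -> x = 0.
  by move=> nx; apply/eqP; rewrite -normr_le0 (le_trans (rV_norm_le_enorm x)).
have [r r0 rUn] : exists2 r : R, 0 < r & forall y, `|y - b| <= r -> Un y.
  have /nbhs_ballP[r /= r0 rUn] := open_nbhs_nbhs (conj openUn Unb).
  exists (r / 2) => [|y yr]; first by rewrite divr_gt0.
  by apply: rUn; rewrite -ball_normE /= distrC; lra.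
pose c : R := n.+1%:R; have c0 : 0 < c by [].
pose d : R := m.+1%:R; have d0 : 0 < d by [].
(* The smallness required of [f (p, b)] by [bilipschitz_zero], for the lower constant [K / c] in the
   sup norm. *)
pose tau := K / c * r / 4.
have tau0 : 0 < tau by rewrite !(divr_gt0, mulr_gt0).
have tM0 : 0 < tau / (2 * M) by rewrite divr_gt0 // mulr_gt0.
(* Space and time each use half of [tau]; the square compensates the square root in time. *)
pose rho := Num.min (tau / (2 * M) / d) ((tau / (2 * M)) ^+ 2).
have rho0 : 0 < rho by rewrite lt_min exprn_gt0 // divr_gt0.
pose V := U `&` ball (t0, x0) rho.
have solvable p : V p -> exists y, Un y /\ f (p, y) = 0.
  case: p => t x [Up [/= ta xa]].
  have [y w yr wr|y w yr wr||y yr fy] := @bilipschitz_zero R n (fun y => f (t, x, y)) b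
      r (K / c) (M * c) r0 (divr_gt0 K0 c0) (mulr_gt0 M0 c0).
  - rewrite mulrAC ler_pdivrMr // [leRHS]mulrC.
    apply: le_trans (enorm_le_rV_norm _).
    apply: le_trans (fK _ _ _ _ Up (rUn _ yr) (rUn _ wr)).
    by rewrite ler_pM2l // rV_norm_le_enorm.
  - apply: (le_trans (rV_norm_le_enorm _)).
    apply: (le_trans (fM _ _ _ _ _ _ Up Up (rUn _ yr) (rUn _ wr))).
    rewrite !subrr enorm0 normr0 sqrtr0 !add0r -mulrA ler_pM2l //.
    exact: enorm_le_rV_norm.
  - apply: (le_trans (rV_norm_le_enorm _)).
    move: ta xa; rewrite -!ball_normE /= => ta xa.
    have := fM t t0 x x0 b b Up Ua Unb Unb.
    rewrite fab0 subr0 subrr enorm0 addr0 => /le_trans; apply.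
    rewrite -/tau -ler_pdivlMl //.
    have -> : M^-1 * tau = tau / (2 * M) + tau / (2 * M) by field; rewrite gt_eqF.
    apply: lerD.
      apply: (le_trans (enorm_le_rV_norm _)); rewrite -/d mulrC -ler_pdivlMr //.
      rewrite distrC (le_trans (ltW xa)) // /rho; by rewrite ge_min lexx.
    rewrite -[leRHS](ger0_norm (ltW tM0)) -[leRHS]sqrtr_sqr ler_sqrt ?sqr_ge0 //.
    rewrite distrC (le_trans (ltW ta)) // /rho; by rewrite ge_min lexx orbT.
  - by exists y; split=> //; exact: rUn.
pose phi p := xget b [set y | Un y /\ f (p, y) = 0].
have phiP p : V p -> Un (phi p) /\ f (p, phi p) = 0.
  by move=> /solvable; exact: xgetPex.
exists V, phi, (M / K); split; split.
- apply: openI => //; exact: ball_open.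
- split=> //; exact: ballxx.
- by move=> p [].
- by move=> p /phiP[].
- by rewrite divr_gt0.
(* Both values of [phi] are compared at [(t, x)] by the lower bound; as [f] vanishes on the graph,
   what remains is the variation of [f] in [p] at fixed [y = phi (s, z)]. *)
- move=> t s x z Vt Vs; have [Ut ft] := phiP _ Vt; have [Us fs] := phiP _ Vs.
  rewrite mulrAC ler_pdivlMr // mulrC.
  apply: (le_trans (fK _ _ _ _ Vt.1 Ut Us)).
  have := fM t s x z (phi (s, z)) (phi (s, z)) Vt.1 Vs.1 Us Us.
  rewrite subrr enorm0 addr0 fs ft => /(le_trans _); apply.
  by rewrite subr0 sub0r /enorm; under eq_bigr do rewrite mxE sqrrN.
apply/seteqP; split=> [[p y] [[/= Vp Uy] fy]|_ [p Vp <-]].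
  exists p => //; congr (_, _); have [Up fp] := phiP p Vp.
  apply/eqP; rewrite -subr_eq0; apply/eqP/enorm_eq0.
  move: Vp Up fp fy; case: p => t x Vp Up fp fy.
  rewrite -(ler_pM2l K0) mulr0; apply: (le_trans (fK _ _ _ _ Vp.1 Up Uy)).
  by rewrite fp fy subrr enorm0.
by have [Up fp] := phiP p Vp; split.
Qed.
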